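(* Let $1\le s$ and $\tfrac12<c<1$. Let $A_N(\omega)$ be the dependence function of $(X,Y)$ when the measure is given by the Nadarajah logistic density $h_N$ with $h_N(\omega)=0$ for $c<\omega<1$, that is, the measure $H_N$ has no atoms and for $\omega\in(0,c)$ $$h_N(\omega)=(s-1)\,c\,(2c-1)^s\,[\omega(c-\omega)]^{s-2}\,\bigl[(2c-1)^s\omega^s+(c-\omega)^s\bigr]^{\frac1s-2}.$$ Then $$A_N(\omega)=\begin{cases}\frac{(1-c)\omega}{c}+\frac1c\bigl[(2c-1)^s\omega^s+(c-\omega)^s\bigr]^{\frac1s} & \text{if } 0\le\omega\le c,\\[4pt] \omega & \text{if } c<\omega\le1,\end{cases}$$ with $1\le s$.
   Context: $(X,Y)$ is a bivariate extreme value pair for minima with exponential margins: $\Pr(X>x,Y>y)=\exp\{-\int_0^1\max[\omega x,(1-\omega)y]\,dH_N(\omega)\}$, where $H_N$ is a finite positive measure on $[0,1]$ with $\int_0^1\omega\,dH_N(\omega)=\int_0^1(1-\omega)\,dH_N(\omega)=1$ and density $h_N$. The dependence function is $$A_N(\omega)=\int_0^1\max\{(1-\omega)q,\ \omega(1-q)\}\,dH_N(q),\qquad 0\le\omega\le1 .$$ The density $h_N$ above is the case $a=0$, $b=c$ of the Nadarajah logistic density on $(a,b)$, with $0\le a<\frac12\le b\le1$, $\alpha=2b-1$, $\beta=1-2a$: $$h_N(\omega)=(s-1)(b-a)(\alpha\beta)^s[(\omega-a)(b-\omega)]^{s-2}[\alpha^s(\omega-a)^s+\beta^s(b-\omega)^s]^{\frac1s-2},\quad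 \omega\in(a,b).$$ This general density is introduced with $s>1$; the claim is asserted for all $s\ge1$. *)

(* Defs.v *)
From HB Require Import structures.
From mathcomp Require Import all_boot all_order all_algebra.
From mathcomp Require Import all_classical all_reals all_analysis.

Set Implicit Arguments.
Unset Strict Implicit.
Unset Printing Implicit Defensive.

Import Order.TTheory GRing.Theory Num.Theory.
Import numFieldNormedType.Exports.

Local Open Scope classical_set_scope.
Local Open Scope ring_scope.

(* A measure on [0, 1] is encoded as a Borel measure on the line that gives
   no mass to the complement of [0, 1]. *)
Definition spectral_measure (R : realType)
    (H : {finite_measure set (measurableTypeR R) -> \bar R}) : Prop :=
  [/\ H (~` `[0, 1]) = 0%E,
      \int[H]_(q in `[0, 1]) q = 1 &
      \int[H]_(q in `[0, 1]) (1 - q) = 1].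

(* The survival function formula is required on the quadrant x, y >= 0, which
   carries all the mass; taking y = 0 or x = 0 gives the unit exponential
   margins. *)
Definition bev_min_pair (R : realType) (d : measure_display)
    (T : measurableType d) (P : probability T R)
    (X Y : {RV P >-> measurableTypeR R})
    (H : {finite_measure set (measurableTypeR R) -> \bar R}) : Prop :=
  spectral_measure H /\
  forall x y : R, 0 <= x -> 0 <= y ->
    P [set t | x < X t /\ y < Y t] =
    (expR (- \int[H]_(q in `[0, 1]) Num.max (q * x) ((1 - q) * y)))%:E.

Definition dependence_function (R : realType)
    (H : {finite_measure set (measurableTypeR R) -> \bar R}) (w : R) : R :=
  \int[H]_(q in `[0, 1]) Num.max ((1 - w) * q) (w * (1 - q)).

Definition atomless (R : realType)
    (H : {finite_measure set (measurableTypeR R) -> \bar R}) : Prop :=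
  forall x : R, H [set x] = 0%E.

(* The density only describes the measure on the open interval (0, 1): a
   spectral measure may in addition have atoms at 0 and 1. *)
Definition has_interior_density (R : realType)
    (H : {finite_measure set (measurableTypeR R) -> \bar R}) (h : R -> R) :
    Prop :=
  forall A : set (measurableTypeR R), measurable A -> A `<=` `]0, 1[ ->
    H A = (\int[lebesgue_measure]_(q in A) (h q)%:E)%E.

Definition nadarajah_logistic (R : realType) (s a b w : R) : R :=
  let alpha := 2 * b - 1 in
  let beta := 1 - 2 * a in
  if (a < w) && (w < b) then
    (s - 1) * (b - a) * (alpha * beta) `^ s
    * ((w - a) * (b - w)) `^ (s - 2)
    * (alpha `^ s * (w - a) `^ s + beta `^ s * (b - w) `^ s) `^ (s^-1 - 2)
  else 0.

(* The case a = 0, b = c of [nadarajah_logistic]; see [hNE]. *)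
Definition hN (R : realType) (s c w : R) : R :=
  if (0 < w) && (w < c) then
    (s - 1) * c * (2 * c - 1) `^ s * (w * (c - w)) `^ (s - 2)
    * ((2 * c - 1) `^ s * w `^ s + (c - w) `^ s) `^ (s^-1 - 2)
  else 0.

Lemma hNE (R : realType) (s c w : R) : hN s c w = nadarajah_logistic s 0 c w.
Proof.
by rewrite /hN /nadarajah_logistic !mulr0 !subr0 !mulr1 powR1 mul1r.
Qed.

(* Main.v *)
Require Import Defs.
From mathcomp Require Import all_boot all_order all_algebra.
From mathcomp Require Import all_classical all_reals all_analysis.
From mathcomp Require Import measurable_realfun lra ring.
Set Implicit Arguments.
Unset Strict Implicit.
Unset Printing Implicit Defensive.
Import Order.TTheory GRing.Theory Num.Theory.
Import numFieldNormedType.Exports.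
Local Open Scope classical_set_scope.
Local Open Scope ring_scope.

(** Let [V x] be the mass that [H] gives to [[0, x]]. Differentiating the
    kernel [max ((1 - w) q, w (1 - q))] in [w] gives [1 - q] for [q < w] and
    [- q] for [q > w], that is [1_{q <= w} - q]; since [q] has integral [1],
    the dependence function [A] has slope [V - 1], so that its second
    derivative is the density of [H]. On the other hand the claimed curve [B]
    is explicit, and differentiating it twice gives back the density [hN].
    Hence [A] and [B] have the same second derivative on [(0, c)] and differ
    there by an affine function. Both are continuous on [[0, c]], and they
    agree at [0], where [A 0] is the first moment of [H], and at [c]: beyond
    [c] the measure has no mass, so [A] has slope [1] from [c] to [1], where
    [A 1 = 1] is the other moment. Therefore [A = B] on [[0, c]] and
    [A w = w] beyond.

    Differentiating under the integral sign is avoided: the slope of [A] is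
    used in the integrated form
    [(y - x) (V x - 1) <= A y - A x <= (y - x) (V y - 1)]
    ([dependence_function_increment]), which follows from a pointwise
    inequality between kernels. Two functions whose increments are sandwiched
    in this way, with slopes that differ by a constant, differ by an affine
    function ([eq_of_slopes_up_to_cst]). The slopes [V] and [B'] are compared
    on closed subintervals of [(0, c)] only ([spectral_cdf_logistic]), where
    the fundamental theorem of calculus applies to the continuous function
    [hN]; the endpoints, near which [hN] may blow up, are reached by the
    continuity of [A] and [B]. *)

(** * Functions determined by their slopes *)

(** Cutting an interval at its midpoint halves the length factor [y - x], while
    the increments of [g] over the two halves add up to the one over the whole.
    So the hypothesis improves itself by a factor [2] at each bisection. *)
Lemma eq_ends_of_increments (R : realType) (f g : R -> R) (a b : R) :
  a <= b ->
  (forall x y, a <= x -> x <= y -> y <= b ->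
    `|f y - f x| <= (y - x) * (g y - g x)) ->
  f b = f a.
Proof.
move=> ab incr.
have bisect n : forall x y, a <= x -> x <= y -> y <= b ->
    2 ^+ n * `|f y - f x| <= (y - x) * (g y - g x).
  elim: n => [|n IH] x y ax xy yb; first by rewrite expr0 mul1r incr.
  pose m := (x + y) / 2.
  have xm : x <= m by rewrite /m; lra.
  have my : m <= y by rewrite /m; lra.
  have := IH x m ax xm (le_trans my yb).
  have := IH m y (le_trans ax xm) my yb.
  rewrite (_ : m - x = (y - x) / 2); last by rewrite /m; field.
  rewrite (_ : y - m = (y - x) / 2); last by rewrite /m; field.
  have : 2 ^+ n * `|f y - f x| <=
         2 ^+ n * `|f y - f m| + 2 ^+ n * `|f m - f x|.
    by rewrite -mulrDr ler_pM2l ?exprn_gt0// ler_distD.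
  by rewrite exprS -mulrA; lra.
apply/eqP; rewrite -subr_eq0 -normr_le0 leNgt; apply/negP => df.
set D := `|f b - f a| in df *.
have /archi_boundP : 0 <= (b - a) * (g b - g a) / D.
  rewrite divr_ge0 ?(ltW df)//.
  by apply: le_trans (incr a b (lexx _) ab (lexx _)).
set n := Num.bound _; rewrite ltr_pdivrMr// => hn.
have := bisect n a b (lexx _) ab (lexx _); apply/negP; rewrite -ltNge.
apply: lt_le_trans hn _; rewrite ler_pM2r// -natrX ler_nat.
exact/ltnW/ltn_expl.
Qed.

(** The hypotheses say that [F] and [G] have the common slope [k] in integrated
    form, a form that makes sense for functions not known to be
    differentiable. *)
Lemma eq_increments (R : realType) (F G k : R -> R) (a b : R) :
  a <= b ->
  (forall x y, a <= x -> x <= y -> y <= b ->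
    (y - x) * k x <= F y - F x <= (y - x) * k y) ->
  (forall x y, a <= x -> x <= y -> y <= b ->
    (y - x) * k x <= G y - G x <= (y - x) * k y) ->
  F b - F a = G b - G a.
Proof.
move=> ab hF hG.
suff : (F \- G) b = (F \- G) a by move=> /=; lra.
apply: (eq_ends_of_increments (g := k) ab) => x y ax xy yb /=.
have /andP[] := hF _ _ ax xy yb; have /andP[] := hG _ _ ax xy yb.
by rewrite ler_norml mulrBr => *; apply/andP; split; lra.
Qed.

Lemma derive_nondecreasing_increment (R : realType) (F K : R -> R) (x y : R) :
  x <= y ->
  (forall z, x <= z <= y -> is_derive z 1 F (K z)) ->
  (forall z t, x <= z -> z <= t -> t <= y -> K z <= K t) ->
  (y - x) * K x <= F y - F x <= (y - x) * K y.
Proof.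
rewrite le_eqVlt => /predU1P[-> _ _|xy dF ndK].
  by rewrite !subrr !mul0r lexx.
have [||z + ->] := @MVT R F K x y xy.
- by move=> z /andP[]; rewrite !bnd_simp => xz zy; apply: dF; rewrite !ltW.
- by apply: derivable_within_continuous => z; rewrite in_itv/= => /dF[].
rewrite in_itv/= => /andP[xz zy].
rewrite ![_ * (y - x)]mulrC !ler_pM2l ?subr_gt0//.
by rewrite !ndK// ltW.
Qed.

(** The increments are known to be linear on the open interval only; continuity
    carries the affine formula to the endpoints, where it must vanish. *)
Lemma affine_on_itv_eq0 (R : realType) (D : R -> R) (a b C : R) :
  a < b -> {within `[a, b], continuous D} -> D a = 0 -> D b = 0 ->
  (forall x y, a < x -> x <= y -> y < b -> D y - D x = (y - x) * C) ->
  forall w, a <= w <= b -> D w = 0.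
Proof.
move=> ab cD Da Db affD.
pose m := (a + b) / 2; pose E z := D z - z * C.
have am : a < m by rewrite /m; lra.
have mb : m < b by rewrite /m; lra.
have Ecst z : a < z -> z < b -> E z = E m.
  move=> az zb; rewrite /E; have [zm|/ltW mz] := leP z m.
    by have := affD z m az zm mb; lra.
  by have := affD m z am mz zb; lra.
have cE : {within `[a, b], continuous E}.
  move=> z; apply: cvgB; first exact: cD.
  by apply: continuous_subspaceT z => z; apply: mulrr_continuous.
have [_ Ea Eb] := (continuous_within_itvP E ab).1 cE.
have EaE : E a = E m.
  apply: (etrans (esym (cvg_lim (@Rhausdorff R) Ea))).
  apply: lim_near_cst => //; near=> z.
  by apply: Ecst; near: z; [exact: nbhs_right_gt|exact: nbhs_right_lt].
have EbE : E b = E m.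
  apply: (etrans (esym (cvg_lim (@Rhausdorff R) Eb))).
  apply: lim_near_cst => //; near=> z.
  by apply: Ecst; near: z; [exact: nbhs_left_gt|exact: nbhs_left_lt].
have C0 : C = 0.
  have : (b - a) * C = 0 by move: EaE EbE; rewrite /E Da Db; lra.
  by move/eqP; rewrite mulf_eq0 subr_eq0 gt_eqF//= => /eqP.
have Em : E m = 0 by rewrite -EaE /E Da C0; lra.
move=> w /andP[]; rewrite !le_eqVlt => /predU1P[<-//|aw] /predU1P[->//|wb].
by have := Ecst w aw wb; rewrite Em /E C0; lra.
Unshelve. all: by end_near. Qed.

(** A function on [[a, b]] is determined by its boundary values and its second
    derivative, the latter being given through the increments of the slopes [U]
    and [K]. *)
Lemma eq_of_slopes_up_to_cst (R : realType) (F G U K : R -> R) (a b : R) :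
  a < b ->
  {within `[a, b], continuous F} -> {within `[a, b], continuous G} ->
  F a = G a -> F b = G b ->
  (forall x y, a < x -> x <= y -> y < b ->
    (y - x) * U x <= F y - F x <= (y - x) * U y) ->
  (forall x y, a < x -> x <= y -> y < b ->
    (y - x) * K x <= G y - G x <= (y - x) * K y) ->
  (forall x y, a < x -> x <= y -> y < b -> U y - U x = K y - K x) ->
  forall w, a <= w <= b -> F w = G w.
Proof.
move=> ab cF cG Fa Fb incF incG UK w wab.
apply/eqP; rewrite -subr_eq0; apply/eqP.
pose m := (a + b) / 2; pose C := U m - K m.
have am : a < m by rewrite /m; lra.
have mb : m < b by rewrite /m; lra.
have UKC x : a < x -> x < b -> U x = K x + C.
  move=> ax xb; rewrite /C; have [xm|/ltW mx] := leP x m.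
    by have := UK x m ax xm mb; lra.
  by have := UK m x am mx xb; lra.
apply: (@affine_on_itv_eq0 R (F \- G) a b C) => //=.
- exact: within_continuousB.
- by rewrite Fa subrr.
- by rewrite Fb subrr.
move=> x y ax xy yb.
(* Adding [C z] to [G] makes its slope equal to that of [F]. *)
suff : F y - F x = (G y + C * y) - (G x + C * x) by lra.
apply: (@eq_increments _ F (fun z => G z + C * z) U) => // z t xz zt ty;
  have az := lt_le_trans ax xz; have tb := le_lt_trans ty yb.
  exact: incF.
have /andP[lo hi] := incG z t az zt tb.
rewrite (UKC z az (le_lt_trans zt tb)) (UKC t (lt_le_trans az zt) tb).
by apply/andP; split; lra.
Qed.

Lemma lipschitz_within_continuous (R : realType) (f : R -> R) (S : set R)
    (k : R) :
  (forall x y, S x -> S y -> `|f x - f y| <= k * `|x - y|) ->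
  {within S, continuous f}.
Proof.
move=> lipf; apply/subspace_continuousP => x Sx.
apply/cvgrPdist_le => e e0; rewrite near_withinE.
have k0 : 0 < `|k| + 1 by rewrite ltr_wpDl.
near=> z => Sz; apply: le_trans (lipf _ _ Sx Sz) _.
have : `|x - z| <= e / (`|k| + 1).
  by near: z; apply: cvgr_dist_le => //; rewrite divr_gt0.
rewrite ler_pdivlMr// => /(le_trans _); apply.
rewrite mulrC ler_wpM2l//.
by rewrite (le_trans (ler_norm k))// lerDl.
Unshelve. all: by end_near. Qed.

(** * The logistic curve and its derivatives *)

Lemma is_derive_powR_subl (R : realType) (c r w : R) : w < c ->
  is_derive w 1 (fun z => (c - z) `^ r) (- (r * (c - w) `^ (r - 1))).
Proof.
move=> wc.
have dsub : is_derive w 1 (fun z : R => c - z) (-1).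
  by apply: is_derive_eq; rewrite add0r mul1r.
have dpow : is_derive (c - w) 1 (@powR R ^~ r) (r * (c - w) `^ (r - 1)).
  by apply: is_derive1_powR; rewrite subr_gt0.
have := @is_derive1_comp R (@powR R ^~ r) (fun z => c - z) w _ _ dpow dsub.
by move/is_derive_eq; apply; rewrite mulrN1.
Qed.

(** With [w `^ (s - 2)] taken as an unknown, the identities between derivatives
    become polynomial. *)
Lemma powR_sub2 (R : realType) (s w : R) : 0 < w ->
  w `^ s = w ^+ 2 * w `^ (s - 2) /\ w `^ (s - 1) = w * w `^ (s - 2).
Proof.
move=> w0; have wn0 : w != 0 by rewrite gt_eqF.
split.
  by rewrite -powR_mulrn ?ltW// -powRD ?wn0 ?implybT//; congr (_ `^ _); ring.
rewrite -[X in X * _](powRr1 (ltW w0)) -powRD ?wn0 ?implybT//.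
by congr (_ `^ _); ring.
Qed.

Lemma continuous_powR_gt0 (R : realType) (r x : R) :
  0 < x -> {for x, continuous (@powR R ^~ r)}.
Proof.
move=> x0; have [+ _] := is_derive1_powR r x0.
by move/derivable1_diffP/differentiable_continuous.
Qed.

Definition logistic_base (R : realType) (s c a w : R) : R :=
  a * w `^ s + (c - w) `^ s.

(** The claimed dependence function on [[0, c]], for [a = (2 * c - 1) `^ s]. *)
Definition logistic_curve (R : realType) (s c a w : R) : R :=
  (1 - c) * w / c + c^-1 * logistic_base s c a w `^ s^-1.

Definition logistic_slope (R : realType) (s c a w : R) : R :=
  (1 - c) / c + c^-1 * (logistic_base s c a w `^ (s^-1 - 1)
    * (a * w `^ (s - 1) - (c - w) `^ (s - 1))).

(** The expression of [hN] on [(0, c)], for [a = (2 * c - 1) `^ s]. *)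
Definition logistic_curvature (R : realType) (s c a w : R) : R :=
  (s - 1) * c * a * (w * (c - w)) `^ (s - 2)
  * logistic_base s c a w `^ (s^-1 - 2).

Section logistic_calculus.
Context (R : realType) (s c a : R) (s_ge1 : 1 <= s) (a_ge0 : 0 <= a).

Lemma logistic_base_gt0 (w : R) : w < c -> 0 < logistic_base s c a w.
Proof.
by move=> wc; rewrite ltr_wpDl ?powR_gt0 ?subr_gt0// mulr_ge0// powR_ge0.
Qed.

Lemma is_derive_logistic_base (w : R) : 0 < w -> w < c ->
  is_derive w 1 (logistic_base s c a)
    (s * (a * w `^ (s - 1) - (c - w) `^ (s - 1))).
Proof.
move=> w0 wc.
have d1 := is_derive1_powR s w0; have d2 := is_derive_powR_subl s wc.
have d3 : is_derive w 1 (fun z => a * z `^ s) (a * (s * w `^ (s - 1))).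
  exact: is_deriveZ.
have := is_deriveD d3 d2.
by move/is_derive_eq; apply; ring.
Qed.

Lemma is_derive_logistic_base_powR (r w : R) : 0 < w -> w < c ->
  is_derive w 1 (fun z => logistic_base s c a z `^ r)
    (r * logistic_base s c a w `^ (r - 1)
     * (s * (a * w `^ (s - 1) - (c - w) `^ (s - 1)))).
Proof.
move=> w0 wc; have dS := is_derive_logistic_base w0 wc.
exact: (@is_derive1_comp R (@powR R ^~ r) (logistic_base s c a) w _ _
  (is_derive1_powR r (logistic_base_gt0 wc)) dS).
Qed.

Lemma is_derive_logistic_curve (w : R) : 0 < w -> w < c ->
  is_derive w 1 (logistic_curve s c a) (logistic_slope s c a w).
Proof.
move=> w0 wc; have s0 : s != 0 by rewrite gt_eqF// (lt_le_trans ltr01).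
have d1 := is_derive_logistic_base_powR s^-1 w0 wc.
have d2 := is_deriveZ c^-1 d1.
have d3 : is_derive w 1 (fun z => (1 - c) * z / c) ((1 - c) / c).
  rewrite (_ : (fun z => _) = (fun z => ((1 - c) / c) *: z)).
    by apply: is_derive_eq; rewrite /GRing.scale/= mulr1.
  by apply/funext => z; rewrite /GRing.scale/=; ring.
have := is_deriveD d3 d2.
move/is_derive_eq; apply; rewrite /logistic_slope /GRing.scale/=.
by field; rewrite s0 andbT gt_eqF// (lt_trans w0).
Qed.

(** With [p = w `^ (s - 2)], [r = (c - w) `^ (s - 2)] and [v = c - w], the
    derivative produces the factor
    [(a p w^2 + r v^2) (a p + r) - (a p w - r v)^2 = a p r (w + v)^2], and
    [w + v = c]. *)
Lemma is_derive_logistic_slope (w : R) : 0 < w -> w < c ->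
  is_derive w 1 (logistic_slope s c a) (logistic_curvature s c a w).
Proof.
move=> w0 wc; have s0 : s != 0 by rewrite gt_eqF// (lt_le_trans ltr01).
have cw0 : 0 < c - w by rewrite subr_gt0.
have c0 : c != 0 by rewrite gt_eqF// (lt_trans w0).
have d1 := is_derive_logistic_base_powR (s^-1 - 1) w0 wc.
have d2 := is_derive_powR_subl (s - 1) wc.
have d3 := is_deriveZ a (is_derive1_powR (s - 1) w0).
have d4 := is_deriveM d1 (is_deriveB d3 d2).
have d5 := is_deriveD (is_derive_cst ((1 - c) / c) w 1) (is_deriveZ c^-1 d4).
move/is_derive_eq: d5; apply.
rewrite /logistic_curvature /GRing.scale/= !fctE.
rewrite powRM ?ltW//.
have -> : s^-1 - 1 - 1 = s^-1 - 2 by ring.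
have -> : s - 1 - 1 = s - 2 by ring.
have S0 := logistic_base_gt0 wc.
have -> : logistic_base s c a w `^ (s^-1 - 1) =
    logistic_base s c a w * logistic_base s c a w `^ (s^-1 - 2).
  rewrite -[X in X * _](powRr1 (ltW S0)) -powRD ?(gt_eqF S0) ?implybT//.
  by congr (_ `^ _); ring.
rewrite -[(a \*: _) w]/(a * w `^ (s - 1)).
move: (logistic_base s c a w `^ _) => Sr.
rewrite /logistic_base.
have [-> ->] := powR_sub2 s w0; have [-> ->] := powR_sub2 s cw0.
by field; rewrite s0.
Qed.

Lemma continuous_logistic_curvature (w : R) : 0 < w -> w < c ->
  {for w, continuous (logistic_curvature s c a)}.
Proof.
move=> w0 wc; have cw0 : 0 < c - w by rewrite subr_gt0.
have dS := is_derive_logistic_base_powR (s^-1 - 2) w0 wc.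
have cS : {for w, continuous (fun z => logistic_base s c a z `^ (s^-1 - 2))}.
  by have [+ _] := dS; move/derivable1_diffP/differentiable_continuous.
apply: cvgM => //; apply: cvgM; first exact: cvg_cst.
apply: (@continuous_cvg _ _ _ _ _ (fun z => z * (c - z)) (@powR R ^~ (s - 2))).
  by apply: continuous_powR_gt0; rewrite mulr_gt0.
by apply: cvgM => //; apply: cvgB => //; exact: cvg_cst.
Qed.

(** Convergence along a general filter [F], as the continuity at the endpoints
    [0] and [c] is one-sided: the powers there have base [0]. *)
Lemma cvg_logistic_curve (F : set_system R) (x : R) : ProperFilter F ->
  z @[z --> F] --> x -> z `^ s @[z --> F] --> x `^ s ->
  (c - z) `^ s @[z --> F] --> (c - x) `^ s ->
  0 < logistic_base s c a x ->
  logistic_curve s c a z @[z --> F] --> logistic_curve s c a x.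
Proof.
move=> FF Fx Fxs Fcxs S0; apply: cvgD.
  by apply: cvgM; [apply: cvgM; [exact: cvg_cst|]|exact: cvg_cst].
apply: cvgM; first exact: cvg_cst.
apply: (@continuous_cvg _ _ _ _ _ (logistic_base s c a) (@powR R ^~ s^-1)).
  exact: continuous_powR_gt0.
by apply: cvgD => //; apply: cvgM => //; exact: cvg_cst.
Qed.

End logistic_calculus.

Lemma continuous_logistic_curve (R : realType) (s c a : R) :
  1 <= s -> 0 < c -> 0 < a ->
  {within `[0, c], continuous (logistic_curve s c a)}.
Proof.
move=> s_ge1 c0 a0; have s0 : 0 < s by rewrite (lt_le_trans ltr01).
have powRs0 : z `^ s @[z --> 0^'+] --> (0 : R) `^ s.
  by rewrite powR0 ?gt_eqF//; exact: powR_cvg0.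
apply/continuous_within_itvP => //; split.
- move=> x; rewrite in_itv/= => /andP[x0 xc].
  have [+ _] := is_derive_logistic_curve s_ge1 (ltW a0) x0 xc.
  by move/derivable1_diffP/differentiable_continuous.
- apply: cvg_logistic_curve => //.
  + exact: cvg_at_right_filter.
  + apply: cvg_at_right_filter.
    have [+ _] := is_derive_powR_subl s c0.
    by move/derivable1_diffP/differentiable_continuous.
  + by apply: logistic_base_gt0 => //; exact: ltW.
- apply: cvg_logistic_curve => //.
  + exact: cvg_at_left_filter.
  + by apply: cvg_at_left_filter; exact: continuous_powR_gt0.
  + rewrite subrr.
    suff sub_right : c - z @[z --> c^'-] --> (0 : R)^'+.
      exact: (cvg_comp _ _ sub_right powRs0).
    move=> A [e /= e0 eA]; exists e => //= z ze zc; apply: eA => /=.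
      by rewrite sub0r normrN.
    by rewrite subr_gt0.
  + by rewrite /logistic_base subrr powR0 ?gt_eqF// addr0 mulr_gt0 ?powR_gt0.
Qed.

(** * The dependence function of a spectral measure *)

Definition spectral_cdf (R : realType)
    (H : {finite_measure set (measurableTypeR R) -> \bar R}) (x : R) : R :=
  fine (H `[0, x]%classic).

(** The derivative at [z] of [fun w => max ((1 - w) * q) (w * (1 - q))]; at the
    kink [z = q] it is the right derivative. *)
Definition kernel_slope (R : realType) (z q : R) : R := \1_`[0, z] q - q.

Lemma integrable_itv01 (R : realType)
    (H : {finite_measure set (measurableTypeR R) -> \bar R})
    (f : measurableTypeR R -> measurableTypeR R) (M : R) :
  measurable_fun setT f -> (forall q, 0 <= q <= 1 -> `|f q| <= M) ->
  H.-integrable `[0, 1] (EFin \o f).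
Proof.
move=> mf fM; apply: measurable_bounded_integrable => //.
- by rewrite ltey_eq fin_num_measure.
- exact: measurable_funTS.
- exists M; split; first exact: num_real.
  by move=> z Mz q /=; rewrite in_itv/= => /fM /le_trans; apply; exact: ltW.
Qed.

Lemma integrable_kernel_slope (R : realType)
    (H : {finite_measure set (measurableTypeR R) -> \bar R}) (z : R) :
  H.-integrable `[0, 1] (EFin \o kernel_slope z).
Proof.
apply: (@integrable_itv01 _ _ _ 1).
  by apply: measurable_funB => //; exact: measurable_indic.
move=> q /andP[q0 q1]; rewrite /kernel_slope indicE.
by case: (_ \in _); rewrite ler_norml /=; apply/andP; split; lra.
Qed.

Lemma integrable_dependence_kernel (R : realType)
    (H : {finite_measure set (measurableTypeR R) -> \bar R}) (w : R) :
  0 <= w <= 1 ->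
  H.-integrable `[0, 1]
    (EFin \o (fun q : R => Num.max ((1 - w) * q) (w * (1 - q)))).
Proof.
move=> /andP[w0 w1]; apply: (@integrable_itv01 _ _ _ 1).
  by apply: measurable_maxr; apply: measurable_funM => //;
    exact: measurable_funB.
move=> q /andP[q0 q1].
by rewrite ler_norml; case: (leP ((1 - w) * q)) => _; apply/andP; split; nra.
Qed.

Lemma integral_kernel_slope (R : realType)
    (H : {finite_measure set (measurableTypeR R) -> \bar R}) (z : R) :
  spectral_measure H -> z <= 1 ->
  \int[H]_(q in `[0, 1]) kernel_slope z q = spectral_cdf H z - 1.
Proof.
move=> [_ Hq _] z1; rewrite RintegralB//.
- rewrite Hq; congr (_ - _).
  rewrite /Rintegral integral_indic// setIidl//.
  by move=> q /=; rewrite !in_itv/= => /andP[-> /le_trans]; apply.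
- apply: (@integrable_itv01 _ _ _ 1); first exact: measurable_indic.
  by move=> q _; rewrite /= indicE; case: (_ \in _); rewrite ?normr1// normr0.
- apply: (@integrable_itv01 _ _ _ 1) => // q /andP[q0 q1].
  by rewrite ger0_norm.
Qed.

(** The kernel is a convex function of [w], as a maximum of two affine ones, so
    its increments lie between the slopes at the two ends. *)
Lemma dependence_kernel_increment (R : realType) (x y q : R) :
  0 <= q <= 1 -> 0 <= x <= y ->
  (y - x) * kernel_slope x q <=
  Num.max ((1 - y) * q) (y * (1 - q)) - Num.max ((1 - x) * q) (x * (1 - q)) <=
  (y - x) * kernel_slope y q.
Proof.
move=> /andP[q0 q1] /andP[x0 xy].
have ind (z : R) : (\1_`[0, z] q : R) = (q <= z)%R%:R.
  by rewrite indicE mem_setE in_itv/= q0.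
rewrite /kernel_slope !ind.
case: (leP ((1 - y) * q)) => ?; case: (leP ((1 - x) * q)) => ?;
  case: (leP q x) => ?; case: (leP q y) => ? /=.
all: by apply/andP; split; nra.
Qed.

(** As [H] has first moment [1], the kernel slope at [z] has mean
    [spectral_cdf H z - 1]. *)
Lemma dependence_function_increment (R : realType)
    (H : {finite_measure set (measurableTypeR R) -> \bar R}) (x y : R) :
  spectral_measure H -> 0 <= x -> x <= y -> y <= 1 ->
  (y - x) * (spectral_cdf H x - 1) <=
    dependence_function H y - dependence_function H x <=
  (y - x) * (spectral_cdf H y - 1).
Proof.
move=> HH x0 xy y1.
have x1 := le_trans xy y1; have y0 := le_trans x0 xy.
have ix : _ := @integrable_dependence_kernel _ H x _.
have iy : _ := @integrable_dependence_kernel _ H y _.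
rewrite -!integral_kernel_slope// -!RintegralZl ?integrable_kernel_slope//.
rewrite /dependence_function -RintegralB ?ix ?iy ?x0 ?y0//.
have iD : H.-integrable `[0, 1] (EFin \o (fun q : R =>
    Num.max ((1 - y) * q) (y * (1 - q)) - Num.max ((1 - x) * q) (x * (1 - q)))).
  by apply: (@integrableB _ _ _ _ _ _ (EFin \o _) (EFin \o _)) => //;
    rewrite ?ix ?iy ?x0 ?y0.
have iZ z : H.-integrable `[0, 1]
    (EFin \o (fun q : R => (y - x) * kernel_slope z q)).
  have m01 : measurable (`[0, 1] : set (measurableTypeR R)) by [].
  exact: (integrableZl m01 (y - x) (integrable_kernel_slope H z)).
have step q : q \in `[0, 1] -> _ := fun q01 =>
  @dependence_kernel_increment R x y q q01 (introT andP (conj x0 xy)).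
apply/andP; split; apply: le_Rintegral => //; try exact: iZ.
  by move=> q /step/andP[].
by move=> q /step/andP[].
Qed.

Lemma spectral_cdfB (R : realType)
    (H : {finite_measure set (measurableTypeR R) -> \bar R}) (x y : R) :
  0 <= x -> x <= y ->
  spectral_cdf H y - spectral_cdf H x = fine (H `]x, y]%classic).
Proof.
move=> x0 xy; rewrite /spectral_cdf.
rewrite (@itv_bndbnd_setU _ _ (BLeft 0) (BRight x) (BRight y)) ?bnd_simp//.
rewrite measureU//; first by rewrite fineD ?fin_num_measure// addrAC subrr add0r.
apply/seteqP; split => // q [] /=; rewrite !in_itv/= => /andP[_ qx] /andP[xq _].
by move: xq; rewrite ltNge qx.
Qed.

(** The total mass is the sum of the two moments. *)
Lemma spectral_cdf1 (R : realType)
    (H : {finite_measure set (measurableTypeR R) -> \bar R}) :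
  spectral_measure H -> spectral_cdf H 1 = 2.
Proof.
move=> [_ Hq H1q].
have iq : H.-integrable `[0, 1] (EFin \o (fun q : R => q)).
  by apply: (@integrable_itv01 _ _ _ 1) => // q /andP[q0 q1]; rewrite ger0_norm.
have i1 : H.-integrable `[0, 1] (EFin \o cst (1 : R)).
  by apply: (@integrable_itv01 _ _ _ 1) => // q _; rewrite normr1.
move: H1q; rewrite RintegralB// Hq Rintegral_cst// mul1r /spectral_cdf; lra.
Qed.

Lemma dependence_function0 (R : realType)
    (H : {finite_measure set (measurableTypeR R) -> \bar R}) :
  spectral_measure H -> dependence_function H 0 = 1.
Proof.
move=> [_ Hq _]; rewrite -[RHS]Hq; apply: eq_Rintegral => q.
rewrite inE/= in_itv/= => /andP[q0 _].
by rewrite subr0 mul1r mul0r; apply/max_idPl.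
Qed.

Lemma dependence_function1 (R : realType)
    (H : {finite_measure set (measurableTypeR R) -> \bar R}) :
  spectral_measure H -> dependence_function H 1 = 1.
Proof.
move=> [_ _ Hq]; rewrite -[RHS]Hq; apply: eq_Rintegral => q.
rewrite inE/= in_itv/= => /andP[_ q1].
by rewrite subrr mul1r mul0r; apply/max_idPr; rewrite subr_ge0.
Qed.

(** The slope [V - 1] ranges from [-1] to [1], so the dependence function is
    1-Lipschitz. *)
Lemma continuous_dependence_function (R : realType)
    (H : {finite_measure set (measurableTypeR R) -> \bar R}) :
  spectral_measure H -> {within `[0, 1], continuous (dependence_function H)}.
Proof.
move=> HH; pose V := spectral_cdf H.
have V2 z : z <= 1 -> 0 <= V z <= 2.
  move=> z1; rewrite -(spectral_cdf1 HH) fine_ge0//=.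
  rewrite fine_le ?fin_num_measure// le_measure ?inE//.
  by apply: subset_itvl; rewrite bnd_simp.
apply: (@lipschitz_within_continuous _ _ _ 1).
have lip x y : 0 <= x -> x <= y -> y <= 1 ->
    `|dependence_function H y - dependence_function H x| <= y - x.
  move=> x0 xy y1; have /andP[V0 _] := V2 _ (le_trans xy y1).
  have /andP[_ V1] := V2 _ y1; rewrite ler_norml.
  have /andP[lo hi] := dependence_function_increment HH x0 xy y1.
  by rewrite -/V in lo hi; apply/andP; split; nra.
move=> x y /=; rewrite !in_itv/= mul1r => /andP[x0 x1] /andP[y0 y1].
have [xy|/ltW yx] := leP x y; last first.
  by rewrite (ger0_norm (_ : 0 <= x - y)) ?subr_ge0// lip.
by rewrite distrC [leRHS]distrC (ger0_norm (_ : 0 <= y - x)) ?subr_ge0// lip.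
Qed.

(** * Spectral measures with the logistic density *)

(** The interval [[x, y]] stays inside [(0, c)], where the density is continuous
    and is the derivative of the slope of the logistic curve. *)
Lemma spectral_cdf_logistic (R : realType)
    (H : {finite_measure set (measurableTypeR R) -> \bar R})
    (s c x y : R) :
  1 <= s -> c < 1 -> has_interior_density H (hN s c) ->
  0 < x -> x <= y -> y < c ->
  spectral_cdf H y - spectral_cdf H x =
  logistic_slope s c ((2 * c - 1) `^ s) y
  - logistic_slope s c ((2 * c - 1) `^ s) x.
Proof.
move=> s1 c1 hdens x0; rewrite le_eqVlt => /predU1P[->|xy yc].
  by rewrite !subrr.
set a := _ `^ s; have a0 : 0 <= a by exact: powR_ge0.
have in0c z : x <= z <= y -> 0 < z < c.
  by move=> /andP[xz zy]; rewrite (lt_le_trans x0)// (le_lt_trans zy).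
have slope_der z : x <= z <= y ->
    is_derive z 1 (logistic_slope s c a) (logistic_curvature s c a z).
  by move=> /in0c /andP[z0 zc]; exact: is_derive_logistic_slope.
have slope_cont z : x <= z <= y -> {for z, continuous (logistic_slope s c a)}.
  by move=> /slope_der[+ _]; move/derivable1_diffP/differentiable_continuous.
have curv_cont : {within `[x, y], continuous (logistic_curvature s c a)}.
  apply: continuous_in_subspaceT => z.
  rewrite inE/= in_itv/= => /in0c/andP[z0 zc].
  exact: continuous_logistic_curvature.
rewrite spectral_cdfB ?ltW// hdens//; last first.
  move=> z /=; rewrite !in_itv/= => /andP[xz zy].
  by rewrite (lt_trans x0)// (le_lt_trans zy)// (lt_trans yc).
transitivity (fine (\int[lebesgue_measure]_(q in `[x, y])
    (logistic_curvature s c a q)%:E)%E).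
  congr fine; rewrite -integral_itv_obnd_cbnd; last first.
    apply: (@measurable_funS _ _ _ _ `[x, y]) => //.
      by apply: subset_itvr; rewrite bnd_simp.
    apply/measurable_EFinP; exact: subspace_continuous_measurable_fun.
  apply: eq_integral => q; rewrite inE/= in_itv/= => /andP[xq qy].
  rewrite /hN (lt_trans x0 xq) (le_lt_trans qy yc)/=.
  by rewrite /logistic_curvature /logistic_base.
rewrite (@continuous_FTC2 _ _ (logistic_slope s c a))//=; last first.
- move=> z; rewrite in_itv/= => /andP[xz zy].
  have [|_ <-] := slope_der z; first by rewrite !ltW.
  by rewrite derive1E.
- split.
  + move=> z; rewrite in_itv/= => /andP[xz zy].
    by have [|] := slope_der z; first by rewrite !ltW.
  + by apply: cvg_at_right_filter; apply: slope_cont; rewrite lexx ltW.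
  + by apply: cvg_at_left_filter; apply: slope_cont; rewrite lexx ltW.
Qed.

(** There is no mass on [(x, 1)], where the density vanishes, nor at [1], which
    is not an atom; so [[0, x]] carries the total mass. *)
Lemma spectral_cdf_saturated (R : realType)
    (H : {finite_measure set (measurableTypeR R) -> \bar R})
    (s c x : R) :
  spectral_measure H -> atomless H -> has_interior_density H (hN s c) ->
  0 < c -> c <= x -> x <= 1 -> spectral_cdf H x = 2.
Proof.
move=> HH noatom hdens c0 cx; rewrite le_eqVlt => /predU1P[->|x1].
  exact: spectral_cdf1.
rewrite -(spectral_cdf1 HH); apply/esym/eqP; rewrite -subr_eq0.
have x0 : 0 < x := lt_le_trans c0 cx.
rewrite spectral_cdfB ?ltW//.
have Hx1 : H `]x, 1[%classic = 0%E.
  rewrite hdens//; last by apply: subset_itvr; rewrite bnd_simp ltW.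
  rewrite integral0_eq//= => q; rewrite in_itv/= => /andP[xq _].
  by rewrite /hN [q < c]ltNge (le_trans cx (ltW xq)) andbF.
rewrite -(@setUitv1 _ _ (BRight x) 1 true) ?bnd_simp//.
rewrite measureU0//; [exact/eqP/(congr1 fine Hx1)|exact: noatom].
Qed.

Theorem proposition6p2 (R : realType) (d : measure_display)
    (T : measurableType d) (P : probability T R)
    (X Y : {RV P >-> measurableTypeR R})
    (H : {finite_measure set (measurableTypeR R) -> \bar R})
    (s c : R) (hs : 1 <= s) (hc : 2^-1 < c) (hc1 : c < 1)
    (hXY : bev_min_pair X Y H)
    (hatom : atomless H) (hdens : has_interior_density H (hN s c))
    (w : R) (hw0 : 0 <= w) (hw1 : w <= 1) :
  dependence_function H w =
  if w <= c then
    (1 - c) * w / c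
    + c^-1 * ((2 * c - 1) `^ s * w `^ s + (c - w) `^ s) `^ (s^-1)
  else w.
Proof.
have HH : spectral_measure H by case: hXY.
have c0 : 0 < c by lra.
have s0 : s != 0 by rewrite gt_eqF// (lt_le_trans ltr01).
have b0 : 0 < 2 * c - 1 by lra.
(* The slope is exactly [1] to the right of [c]. *)
have A_right x : c <= x -> x <= 1 -> dependence_function H x = x.
  move=> cx x1; have /andP[] := dependence_function_increment HH
    (ltW (lt_le_trans c0 cx)) x1 (lexx 1).
  rewrite !(spectral_cdf_saturated HH hatom hdens)// ?(ltW hc1)//.
  by rewrite (dependence_function1 HH); lra.
case: ifP => [wc|/negbT]; last first.
  by rewrite -ltNge => /ltW cw; exact: A_right.
set a := (2 * c - 1) `^ s; have a0 : 0 < a by rewrite powR_gt0.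
rewrite -[RHS]/(logistic_curve s c a w).
apply: (eq_of_slopes_up_to_cst (a := 0) (b := c)
  (U := fun x => spectral_cdf H x - 1) (K := logistic_slope s c a)) => //.
- apply: continuous_subspaceW (continuous_dependence_function HH).
  by apply: subset_itvl; rewrite bnd_simp ltW.
- exact: continuous_logistic_curve.
- rewrite (dependence_function0 HH) /logistic_curve /logistic_base.
  rewrite powR0// !mulr0 mul0r !add0r subr0 -powRrM divff// powRr1 ?ltW//.
  by rewrite mulVf// gt_eqF.
- rewrite A_right ?(ltW hc1)// /logistic_curve /logistic_base.
  rewrite subrr powR0// addr0 /a -powRM ?ltW// -powRrM divff// powRr1.
    by field; rewrite gt_eqF.
  by rewrite mulr_ge0 ?ltW.
- move=> x y x0 xy yc; apply: dependence_function_increment => //.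
    exact: ltW.
  exact: ltW (lt_trans yc hc1).
- move=> x y x0 xy yc; apply: derive_nondecreasing_increment => //.
    move=> z /andP[xz zy]; apply: is_derive_logistic_curve => //.
    + exact: ltW.
    + exact: lt_le_trans x0 xz.
    + exact: le_lt_trans zy yc.
  move=> z t xz zt ty; have z0 := lt_le_trans x0 xz.
  (* The logistic slope increases because [H] is nonnegative. *)
  rewrite -subr_ge0.
  rewrite -(spectral_cdf_logistic hs hc1 hdens z0 zt (le_lt_trans ty yc)).
  by rewrite (spectral_cdfB H (ltW z0) zt) fine_ge0.
- move=> x y x0 xy yc.
  rewrite -(spectral_cdf_logistic hs hc1 hdens x0 xy yc); ring.
- by rewrite hw0.
Qed.
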